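(* Let $A(1), A(2), A(3), \ldots$ be a sequence of graded lattices equipped with a homothety system $\mathcal H=\{H_{ij} : i,j\ge 1\}$, and assume that the sequence equipped with $\mathcal H$ is good. Let $n$ and $k$ be positive integers. Then there is a positive integer $N$ such that whenever $\chi: A(N)\to \{1,\ldots,k\}$ is a $k$-coloring of $A(N)$, there is a restricted lattice homothety $h: A(n)\to A(N)$ (i.e. $h\in H_{nN}$) whose image is $\chi$-monochromatic (i.e. $\chi$ is constant on $h(A(n))$).
   Context: A poset $P$ is graded if it carries a rank function $r_P:P\to\mathbb N_0$ (where $\mathbb N_0$ is the set of non-negative integers) that is strictly increasing and satisfies $r_P(p')=r_P(p)+1$ whenever $p'$ covers $p$; a graded lattice is a lattice that is graded as a poset, with a fixed rank function. The product $P\times Q$ of graded posets has the componentwise order and rank function $r(p,q)=r_P(p)+r_Q(q)$; the product of two lattices is a lattice with componentwise join and meet. Homothety: for graded posets $P,Q$, a map $f:P\to Q$ is a homothety if (a) $f(p)\le f(p')$ if and only if $p\le p'$, and (b) there is $d\ge 1$ (the scale factor) such that $r_Q(f(p))-r_Q(f(p'))=d\,(r_P(p)-r_P(p'))$ for all $p,p'\in P$. For graded lattices $P,Q$, $f$ is a lattice homothety if it is a homothety and $f(p\vee p')=f(p)\vee f(p')$, $f(p\wedge p')=f(p)\wedge f(p')$ for all $p,p'\in P$. Homothety system: given a sequence $A(1),A(2),\ldots$ of graded lattices and for all $i,j\geq 1$ a collection $H_{ij}$ of lattice homotheties from $A(i)$ to $A(j)$, $\mathcal H=\{H_{ij}\}$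 is a homothety system if the identity map of $A(i)$ is in $H_{ii}$ for all $i$, and $\psi\circ\varphi\in H_{ik}$ whenever $\varphi\in H_{ij}$ and $\psi\in H_{jk}$. Elements of the $H_{ij}$ are called restricted lattice homotheties. Compatible: a lattice homothety $\varphi:A(m)\times A(n)\to A(N)$ is compatible with $\mathcal H$ if (1) whenever $g:A(i)\to A(m)\times A(n)$ is a lattice homothety such that both $\mathrm{proj}_1\circ g:A(i)\to A(m)$ and $\mathrm{proj}_2\circ g:A(i)\to A(n)$ are restricted lattice homotheties, the composition $\varphi\circ g:A(i)\to A(N)$ is a restricted lattice homothety; and (2) for all $p\in A(m)$ and $q\in A(n)$, the maps $A(n)\to A(N)$, $y\mapsto\varphi(p,y)$, and $A(m)\to A(N)$, $x\mapsto\varphi(x,q)$, are restricted lattice homotheties. Good: the sequence $A(1),A(2),\ldots$ equipped with $\mathcal H$ is good if for all $N_1,N_2\ge1$ there is $N\geq 1$ and a lattice homothety $A(N_1)\times A(N_2)\to A(N)$ compatible with $\mathcal H$.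
   Formalization: The lattice A(n) is additionally assumed finite; without this the claim fails, e.g. for A(i) = N_0^i with all lattice homotheties, n = 1, k = 2, coloring p by the parity of floor(log2(rank(p)+1)). *)

(* Defs.v *)
From HB Require Import structures.
From mathcomp Require Import all_boot all_order all_algebra.
From mathcomp Require Import all_classical.

Set Implicit Arguments.
Unset Strict Implicit.
Unset Printing Implicit Defensive.

Import Order.TTheory GRing.Theory Num.Theory.

Local Open Scope order_scope.

Definition covers (d : Order.disp_t) (P : porderType d) (p' p : P) : Prop :=
  p < p' /\ forall z : P, ~ (p < z /\ z < p').

HB.mixin Record isGraded (d : Order.disp_t) P of Order.POrder d P := {
  rank : P -> nat;
  rank_lt : forall p p' : P, p < p' -> (rank p < rank p')%N;
  rank_covers : forall p p' : P, covers p' p -> rank p' = (rank p).+1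
}.

#[short(type="gradedPOrderType")]
HB.structure Definition GradedPOrder (d : Order.disp_t) :=
  { P of Order.POrder d P & isGraded d P }.

#[short(type="gradedLatticeType")]
HB.structure Definition GradedLattice (d : Order.disp_t) :=
  { P of Order.Lattice d P & isGraded d P }.

Section ProductRank.
Context {d1 d2 d3 : Order.disp_t}.
Variables (P : gradedPOrderType d1) (Q : gradedPOrderType d2).

Definition prod_rank (u : P *prod[d3] Q) : nat := (rank u.1 + rank u.2)%N.

Lemma prod_rank_lt (u v : P *prod[d3] Q) :
  u < v -> (prod_rank u < prod_rank v)%N.
Proof.
have le_rank (d : Order.disp_t) (T : gradedPOrderType d) (x y : T) :
    x <= y -> (rank x <= rank y)%N.
  by rewrite le_eqVlt => /predU1P[-> // | /rank_lt /ltnW].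
rewrite lt_def leEprod /prod_rank => /andP[neq /andP[le1 le2]].
case: (eqVneq u.1 v.1) => [e1 | n1].
  rewrite e1 ltn_add2l; apply: rank_lt; rewrite lt_neqAle le2 andbT.
  apply: contraNneq neq => e2; apply/eqP.
  by case: u v e1 e2 {le1 le2} => [u1 u2] [v1 v2] /= -> ->.
rewrite -addSn; apply: leq_add; last exact: le_rank.
by apply: rank_lt; rewrite lt_neqAle n1.
Qed.

Lemma prod_rank_covers (u v : P *prod[d3] Q) :
  covers v u -> prod_rank v = (prod_rank u).+1.
Proof.
case: u v => [p q] [p' q'] [lt_uv nobetween].
have /andP[/= lep leq_] : (p <= p') && (q <= q').
  by have := ltW lt_uv; rewrite leEprod.
have ltE (a b : P) (a' b' : Q) :
    ((a, a') : P *prod[d3] Q) < (b, b') =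
    [&& (b != a) || (b' != a'), a <= b & a' <= b'].
  by rewrite lt_def leEprod xpair_eqE negb_and.
rewrite /prod_rank /=.
case: (eqVneq p p') => [ep | np].
  subst p'; rewrite -addnS; congr (_ + _)%N; apply: rank_covers; split.
    by move: lt_uv; rewrite ltE eqxx /= lexx lt_def.
  move=> z [ltz zlt]; apply: (nobetween (p, z)).
  by rewrite !ltE eqxx /= lexx /= -!lt_def.
case: (eqVneq q q') => [eq_ | nq].
  subst q'; rewrite -addSn; congr (_ + _)%N; apply: rank_covers; split.
    by rewrite lt_neqAle np.
  move=> z [ltz zlt]; apply: (nobetween (z, q)).
  by rewrite !ltE eqxx /= !orbF lexx !andbT -!lt_def.
case: (nobetween (p', q)).
by rewrite !ltE !lexx lep leq_ [p' == p]eq_sym [q' == q]eq_sym np nq orbT.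
Qed.

HB.instance Definition _ :=
  isGraded.Build d3 (P *prod[d3] Q) prod_rank_lt prod_rank_covers.
End ProductRank.

HB.instance Definition _ (d1 d2 d3 : Order.disp_t)
    (P : gradedLatticeType d1) (Q : gradedLatticeType d2) :=
  GradedPOrder.on (P *prod[d3] Q).

Definition homothety (d1 d2 : Order.disp_t)
    (P : gradedPOrderType d1) (Q : gradedPOrderType d2) (f : P -> Q) : Prop :=
  (forall p p' : P, f p <= f p' <-> p <= p') /\
  (exists d : nat, (1 <= d)%N /\ forall p p' : P,
     ((rank (f p))%:Z - (rank (f p'))%:Z
        = d%:Z * ((rank p)%:Z - (rank p')%:Z))%R).

Definition lattice_homothety (d1 d2 : Order.disp_t)
    (P : gradedLatticeType d1) (Q : gradedLatticeType d2) (f : P -> Q) : Prop :=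
  [/\ homothety f,
      forall p p' : P, f (p `|` p') = f p `|` f p'
    & forall p p' : P, f (p `&` p') = f p `&` f p'].

(* Sequences are indexed from 1: A 0 and the H i j with i = 0 or j = 0 are
   junk values, excluded by the positivity hypotheses. *)
Record homothety_system (d : Order.disp_t) (A : nat -> gradedLatticeType d)
    (H : forall i j : nat, set (A i -> A j)) : Prop := {
  restricted_homothety : forall i j : nat, (1 <= i)%N -> (1 <= j)%N ->
    forall f : A i -> A j, H i j f -> lattice_homothety f;
  restricted_id : forall i : nat, (1 <= i)%N -> H i i (fun x => x);
  restricted_comp : forall i j k : nat,
    (1 <= i)%N -> (1 <= j)%N -> (1 <= k)%N ->
    forall (f : A i -> A j) (g : A j -> A k),
    H i j f -> H j k g -> H i k (g \o f)
}.

Definition compatible (d : Order.disp_t) (A : nat -> gradedLatticeType d)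
    (H : forall i j : nat, set (A i -> A j)) (m n N : nat)
    (phi : A m *p A n -> A N) : Prop :=
  [/\ forall (i : nat) (g : A i -> A m *p A n), (1 <= i)%N ->
        lattice_homothety g -> H i m (fun x => (g x).1) ->
        H i n (fun x => (g x).2) -> H i N (phi \o g),
      forall p : A m, H n N (fun y => phi (p, y))
    & forall q : A n, H m N (fun x => phi (x, q))].

Definition good (d : Order.disp_t) (A : nat -> gradedLatticeType d)
    (H : forall i j : nat, set (A i -> A j)) : Prop :=
  forall N1 N2 : nat, (1 <= N1)%N -> (1 <= N2)%N ->
  exists N : nat, (1 <= N)%N /\
    exists phi : A N1 *p A N2 -> A N,
      lattice_homothety phi /\ compatible H phi.

(* Main.v *)
Require Import Defs.
From mathcomp Require Import all_boot all_order all_algebra.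
From mathcomp Require Import finmap.
From mathcomp Require Import all_classical.

(** The Hales-Jewett theorem for the alphabet A(n) gives a monochromatic
    combinatorial line in A(n)^M for any finite coloring.  Iterating goodness,
    one maps A(n)^M to some A(N) by x_1...x_M |-> phi_1(x_1, phi_2(x_2, ...)).
    Each combinatorial line becomes a restricted lattice homothety: a fixed
    letter, or a fixed remainder of the word, is absorbed by condition (2) of
    compatibility, and a moving letter in front of a moving remainder by
    condition (1).  Hales-Jewett itself is proved by color focusing, with an
    induction on the set of letters on which the line has to be
    monochromatic. *)

Set Implicit Arguments.
Unset Strict Implicit.
Unset Printing Implicit Defensive.

Import Order.TTheory GRing.Theory.

(* A combinatorial line is a word over [option T] in which [None] is the
   moving letter. *)
Definition subst_word (T : Type) (w : seq (option T)) (x : T) : seq T :=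
  map (odflt x) w.

Lemma size_subst_word (T : Type) (w : seq (option T)) (x : T) :
  size (subst_word w x) = size w.
Proof. exact: size_map. Qed.

Lemma subst_word_cat (T : Type) (v w : seq (option T)) (x : T) :
  subst_word (v ++ w) x = subst_word v x ++ subst_word w x.
Proof. exact: map_cat. Qed.

Lemma subst_word_Some (T : Type) (u : seq T) (x : T) :
  subst_word (map Some u) x = u.
Proof. by rewrite /subst_word -map_comp map_id. Qed.

Lemma subst_word_fixed (T : eqType) (w : seq (option T)) (x y : T) :
  None \notin w -> subst_word w x = subst_word w y.
Proof. by move=> wN; apply/eq_in_map => -[//|] wN'; rewrite wN' in wN. Qed.

Lemma subst_word_map (T U : Type) (f : T -> U) (w : seq (option T)) (x : T) :
  subst_word (map (omap f) w) (f x) = map f (subst_word w x).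
Proof. by rewrite /subst_word -!map_comp; apply: eq_map => -[]. Qed.

Definition monochromatic_line (T : eqType) (C : Type) (s : seq T)
    (chi : seq T -> C) (w : seq (option T)) : Prop :=
  None \in w /\
  {in s &, forall x y, chi (subst_word w x) = chi (subst_word w y)}.

(** [C] is bound inside because the induction also uses colorings whose colors are functions on
    words. *)
Definition hales_jewett_on (T : eqType) (s : seq T) : Prop :=
  forall C : finType, exists M : nat, forall chi : seq T -> C,
  exists2 w, size w = M & monochromatic_line s chi w.

(* Lines, one of each color in [cs], which are monochromatic on [s] and take
   a common value at [a]. *)
Definition color_focused (T C : eqType) (s : seq T) (a : T)
    (chi : seq T -> C) (M : nat) (cs : seq C) : Prop :=
  exists2 f : seq T, size f = M &
  forall c, c \in cs -> exists w : seq (option T),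
    [/\ size w = M, None \in w, subst_word w a = f
      & forall x, x \in s -> chi (subst_word w x) = c].

(** Induction on [r]: a new block is put in front of the words. Either the color at the old focus
    repeats, which completes a line at [a], or it supplies one more line. *)
Lemma color_focusing (T C : finType) (s : seq T) (a : T) (r : nat) :
  hales_jewett_on s ->
  exists M : nat, forall chi : seq T -> C,
    (exists2 w, size w = M & monochromatic_line (a :: s) chi w) \/
    (exists cs : seq C,
       [/\ uniq cs, size cs = r & color_focused s a chi M cs]).
Proof.
move=> HJs; elim: r => [|r [M IH]].
  by exists 0 => chi; right; exists [::]; split=> //; exists [::].
(* A color is now the whole coloring of the tails of length [M], so letters of [s] put into [W] are
   interchangeable in front of every tail. *)
have [L HL] := HJs {ffun M.-tuple T -> C}.
exists (L + M) => chi.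
have [W szW [WN Wmono]] :=
  HL (fun u => [ffun v : M.-tuple T => chi (u ++ v)]).
(* For empty [s] this is [a], and [Wx0] below is vacuous. *)
set x0 := head a s.
have Wx0 (v : seq T) x : size v = M -> x \in s ->
    chi (subst_word W x ++ v) = chi (subst_word W x0 ++ v).
  move=> /eqP szv xs.
  have x0s : x0 \in s by rewrite /x0; case: (s) xs => //= *; rewrite mem_head.
  by have /ffunP/(_ (Tuple szv)) := Wmono _ _ xs x0s; rewrite !ffunE.
have lift_line w : size w = M ->
    monochromatic_line (a :: s) (fun v => chi (subst_word W x0 ++ v)) w ->
    exists2 w', size w' = L + M & monochromatic_line (a :: s) chi w'.
  move=> szw [wN wmono]; exists (map Some (subst_word W x0) ++ w).
    by rewrite size_cat size_map size_subst_word szW szw.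
  split; first by rewrite mem_cat wN orbT.
  by move=> x y xs ys; rewrite !subst_word_cat !subst_word_Some; apply: wmono.
have [[w szw wmono]|[cs [cs_uniq szcs [f szf Hf]]]] :=
  IH (fun v => chi (subst_word W x0 ++ v)).
  by left; apply: lift_line szw wmono.
pose c0 := chi (subst_word W x0 ++ f).
have [c0cs|c0cs] := boolP (c0 \in cs).
  left; have [w [szw wN wa wc]] := Hf _ c0cs.
  apply: lift_line (szw) _; split=> //.
  have wc0 x : x \in a :: s -> chi (subst_word W x0 ++ subst_word w x) = c0.
    by rewrite inE => /predU1P[->|/wc //]; rewrite wa.
  by move=> x y xs ys; rewrite !wc0.
right; exists (c0 :: cs); split; rewrite /= ?c0cs ?szcs //.
exists (subst_word W a ++ f); first by rewrite size_cat size_subst_word szW szf.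
move=> c; rewrite inE => /predU1P[->|/Hf[w [szw wN wa wc]]].
  (* The line of the new color moves in [W] only. *)
  exists (W ++ map Some f); split.
  - by rewrite size_cat size_map szW szf.
  - by rewrite mem_cat WN.
  - by rewrite subst_word_cat subst_word_Some.
  - by move=> x xs; rewrite subst_word_cat subst_word_Some Wx0.
(* An old line moves together with [W], which brings it to the new focus at [a]. *)
exists (W ++ w); split.
- by rewrite size_cat szW szw.
- by rewrite mem_cat WN.
- by rewrite subst_word_cat wa.
- by move=> x xs; rewrite subst_word_cat Wx0 ?wc // size_subst_word.
Qed.

Theorem hales_jewett (T : finType) (s : seq T) : hales_jewett_on s.
Proof.
elim: s => [C|a s IHs C]; first by exists 1 => chi; exists [:: None].
(* With more focused lines than colors, the pigeonhole principle excludes the second alternative. *)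
have [M HM] := @color_focusing T C s a #|C|.+1 IHs.
exists M => chi; have [//|[cs [cs_uniq szcs _]]] := HM chi.
by have := max_card (mem cs); rewrite (card_uniqP cs_uniq) szcs ltnn.
Qed.

Section RestrictedHomotheties.

(** The rank of a pair is a sum, so the scale factors add. *)
Lemma lattice_homothety_pair (d0 d1 d2 : Order.disp_t)
    (P : gradedLatticeType d0) (Q1 : gradedLatticeType d1)
    (Q2 : gradedLatticeType d2) (f : P -> Q1) (g : P -> Q2) :
  lattice_homothety f -> lattice_homothety g ->
  lattice_homothety (fun x => (f x, g x) : Q1 *p Q2).
Proof.
move=> [[f_le [df [df_gt0 f_rank]]] fU fI] [[g_le [dg [_ g_rank]]] gU gI].
split=> [|p p'|p p']; last 2 first.
- by rewrite fU gU.
- by rewrite fI gI.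
split=> [p p'|].
  rewrite leEprod /=; split=> [/andP[/f_le //]|lepp'].
  by apply/andP; split; [apply/f_le | apply/g_le].
exists (df + dg)%N; split=> [|p p']; first by rewrite ltn_addr.
rewrite {1 2}/rank /= /prod_rank /= !PoszD mulrDl -f_rank -g_rank.
by rewrite opprD addrACA.
Qed.

Variables (d : Order.disp_t) (A : nat -> gradedLatticeType d).
Variable H : forall i j : nat, set (A i -> A j).
Hypotheses (H_system : homothety_system H) (H_good : good H).

Lemma word_embedding (n M : nat) (a : A n) : (1 <= n)%N ->
  exists N : nat, (1 <= N)%N /\ exists Phi : seq (A n) -> A N,
    forall w : seq (option (A n)), size w = M -> None \in w ->
    H (fun x => Phi (subst_word w x)).
Proof.
move=> n_gt0; elim: M => [|M [L [L_gt0 [Psi HPsi]]]].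
  (* Vacuous: the empty word has no moving letter. *)
  by exists n; split=> //; exists (fun=> a) => -[].
have [N [N_gt0 [phi [_ [phi_diag phi_l phi_r]]]]] := H_good n_gt0 L_gt0.
exists N; split=> //; exists (fun u => phi (head a u, Psi (behead u))).
move=> [//|o w] [szw]; rewrite inE /=.
have [wN _|wN] := boolP (None \in w).
  have HPw := HPsi w szw wN; case: o => [c|] /=.
    exact: (restricted_comp H_system n_gt0 L_gt0 N_gt0 HPw (phi_l c)).
  have Hid := restricted_id H_system n_gt0.
  apply: (phi_diag _ (fun x => (x, Psi (subst_word w x)))) => //.
  by apply: lattice_homothety_pair;
    [apply: (restricted_homothety H_system _ _ Hid)
    |apply: (restricted_homothety H_system _ _ HPw)].
(* Only the head moves, so the fixed remainder can be evaluated at [a]. *)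
rewrite orbF => /eqP <- /=.
rewrite (_ : (fun x => _) = (fun x => phi (x, Psi (subst_word w a)))) //.
by apply/funext => x; rewrite -/(subst_word w x) (subst_word_fixed x a wN).
Qed.

End RestrictedHomotheties.

Theorem theorem3p1 (d : Order.disp_t) (A : nat -> gradedLatticeType d)
    (H : forall i j : nat, set (A i -> A j))
    (H_system : homothety_system H) (H_good : good H)
    (n k : nat) (n_gt0 : (1 <= n)%N) (k_gt0 : (1 <= k)%N)
    (A_n_finite : finite_set [set: A n]%classic) :
  exists N : nat, (1 <= N)%N /\
    forall chi : A N -> 'I_k,
    exists h : A n -> A N, H n N h /\
      forall x y : A n, chi (h x) = chi (h y).
Proof.
have [[a]|A0] := pselect (inhabited (A n)); last first.
  exists n; split=> // chi; exists (fun x => x).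
  by split=> [|x]; [exact: restricted_id | case: A0; split].
(* Hales-Jewett needs a finite type of letters: [X] provides it, and [val] carries its words back to
   [A n]. *)
have [X AX] := finite_fsetP.1 A_n_finite.
have XT x : x \in X by have : [set` X]%classic x by rewrite -AX.
have [M HJ] := hales_jewett (enum {: X}) 'I_k.
have [N [N_gt0 [Phi HPhi]]] := word_embedding H_system H_good M a n_gt0.
exists N; split=> // chi.
have [w szw [wN wmono]] := HJ (fun u => chi (Phi (map val u))).
exists (fun x => Phi (subst_word (map (omap val) w) x)); split.
  apply: HPhi; first by rewrite size_map.
  by apply/mapP; exists None.
move=> x y.
have := wmono [` XT x]%fset [` XT y]%fset; rewrite !mem_enum => /(_ isT isT).
by rewrite -!subst_word_map.
Qed.
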